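(* Let $A \subset \mathbb{N}$ be either $\mathbb{N}$ or $\{1,\dots,N\}$ for some $N \in \mathbb{N}$. Let $(\mathscr{G}, d_{\mathscr{G}})$ be a separable metric semigroup, let $z_0, z_1 \in \mathscr{G}$, and let $X_n \in L^0(\Omega,\mathscr{G})$ ($n \in A$) be independent. Put $S_n := X_1 X_2 \cdots X_n$ for $n \in A$. If $\sup_{n \in A} d_{\mathscr{G}}(z_1, z_0 S_n) < \infty$ almost surely, then for all $p \in (0,\infty)$, \[ \mathbb{E}_\mu\left[\sup_{n \in A} d_{\mathscr{G}}(z_0, z_0 X_n)^p\right] < \infty \quad\Longleftrightarrow\quad \mathbb{E}_\mu\left[\sup_{n \in A} d_{\mathscr{G}}(z_1, z_0 S_n)^p\right] < \infty . \]
   Context: A metric semigroup is a semigroup $(\mathscr{G},\cdot)$ (a set with an associative binary operation) equipped with a metric $d_{\mathscr{G}}:\mathscr{G}\times\mathscr{G}\to[0,\infty)$ that is translation-invariant: $d_{\mathscr{G}}(ac,bc)=d_{\mathscr{G}}(a,b)=d_{\mathscr{G}}(ca,cb)$ for all $a,b,c\in\mathscr{G}$. It need not be commutative nor have an identity. It is separable if the metric space $(\mathscr{G},d_{\mathscr{G}})$ is separable. $(\Omega,\mathscr{A},\mu)$ is a probability space, $L^0(\Omega,\mathscr{G})$ is the set of $\mathscr{G}$-valued random variables (maps $\Omega\to\mathscr{G}$ measurable with respect to the Borel $\sigma$-algebra of $\mathscr{G}$), and $\mathbb{E}_\mu$ denotes expectation with respect to $\mu$. Here $\mathbb{N}=\{1,2,\dots\}$.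 *)

(* Defs.v *)
From HB Require Import structures.
From mathcomp Require Import all_boot all_order all_algebra finmap.
From mathcomp Require Import all_classical all_reals all_analysis.

Set Implicit Arguments.
Unset Strict Implicit.
Unset Printing Implicit Defensive.

Import Order.TTheory GRing.Theory Num.Theory.
Local Open Scope classical_set_scope.
Local Open Scope ring_scope.

HB.mixin Record isTranslationInvariant (R : numDomainType) G
    & Metric R G & Semigroup G := {
  mdist_mulr : forall c a b : G, mdist (a * c)%g (b * c)%g = mdist a b ;
  mdist_mull : forall c a b : G, mdist (c * a)%g (c * b)%g = mdist a b
}.

#[short(type="metricSemigroupType")]
HB.structure Definition MetricSemigroup (R : numDomainType) :=
  { G of Metric R G & Semigroup G & isTranslationInvariant R G }.

Definition separable (T : topologicalType) :=
  exists D : set T, countable D /\ dense D.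

(* The sigma-algebra is passed as a set of sets because a [measurableType]
   is required to be pointed, which a topological space need not be. *)
Definition borel (T : topologicalType) : set (set T) := <<s @open T >>.

Definition borel_measurable (d : measure_display) (Omega : measurableType d)
    (T : topologicalType) (X : Omega -> T) :=
  forall B : set T, borel B -> measurable (X @^-1` B).

(* Mutual independence of the family (X i), i ranging over the elements of A;
   the values of X outside A are irrelevant. *)
Definition independent_on (d : measure_display) (Omega : measurableType d)
    (R : realType) (mu : probability Omega R) (T : topologicalType)
    (I : choiceType) (A : set I) (X : I -> Omega -> T) :=
  forall (J : {fset I}) (B : I -> set T),
    [set` J] `<=` A -> (forall i, i \in J -> borel (B i)) ->
    mu (\bigcap_(i in [set` J]) (X i @^-1` B i)) =
    (\prod_(i <- J) mu (X i @^-1` B i))%E.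

(* partial_prod x n = x 1 * x 2 * ... * x n for n >= 1. There is no unit, so
   the value at n = 0 (set to x 1) is a dummy. *)
Fixpoint partial_prod (G : semigroupType) (x : nat -> G) (n : nat) : G :=
  match n with
  | 0%N | 1%N => x 1%N
  | m.+1 => (partial_prod x m * x n)%g
  end.

Definition positive_initial_segment (A : set nat) :=
  A = [set n | (1 <= n)%N] \/
  exists N : nat, (1 <= N)%N /\ A = [set n | (1 <= n <= N)%N].

(* Main.v *)
Require Import Defs.
From HB Require Import structures.
From mathcomp Require Import all_boot all_order all_algebra finmap.
From mathcomp Require Import all_classical all_reals all_analysis.
From mathcomp Require Import measurable_realfun ring lra.

Import Order.TTheory GRing.Theory Num.Theory.
Local Open Scope classical_set_scope.
Local Open Scope ring_scope.
Set Implicit Arguments.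
Unset Strict Implicit.
Unset Printing Implicit Defensive.

(** Translation invariance makes d(y, y x) independent of y
    ([mdist_mul_self]), so every x in the semigroup has a well-defined size
    |x|, and d(z0 S_k, z0 S_j) = |X_(k+1) ... X_j| for k < j although there is
    neither a unit nor an inverse: an increment of the walk depends only on
    the later factors. Write g_n = d(z1, z0 S_n), g^* = sup_n g_n and
    X^* = sup_n |X_n|.

    Moments of X^* control those of g^* through an inequality of
    Hoffmann-Jorgensen type ([hoffmann_jorgensen]): for t >= d(z1, z0) and a >= 0,

      P(g^* > t + s + 2a) <= P(X^* > s) + P(g^* > a) P(g^* > t).

    Stop at the first k with g_k > t. If no step exceeds s then g_k <= t + s,
    so to pass t + s + 2a some later block X_(k+1) ... X_j must have size
    > 2a; that event is independent of the stopping at k, and it forces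
    g_k > a or g_j > a by the triangle inequality. Independence of the past
    and the future of k is the pi-lambda argument [independent_generated];
    that these events belong to the right sigma-algebras uses separability,
    which makes products of random variables Borel ([borel_measurable_mul]).

    As g^* is finite almost surely, a can be chosen with
    P(g^* > a) <= 1 / (2 * 3^p). For t = s = b 3^k with b large this reads

      P(g^* > b 3^(k+1)) <= P(X^* > b 3^k) + P(g^* > b 3^k) / (2 * 3^p).

    A p-th moment is finite exactly when the tails along the levels b 3^k,
    weighted by 3^(kp), are summable ([sup_pow_le], [level_sum_le]). After
    weighting, the second term on the right contributes at most half of the
    sum being estimated, and it is absorbed ([weighted_sum_le]); since all
    partial sums are finite, no truncation of the random variables is needed.

    In the other direction, a step of size > 3t with t >= d(z1, z0) forces
    g > t at one of its two endpoints, which is again an inequality between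
    consecutive levels. Both directions are thus instances of
    [moment_transfer]. *)

(** * Products of random variables *)

Lemma borel_measurable_open (d : measure_display) (Omega : measurableType d)
    (T : topologicalType) (X : Omega -> T) :
  (forall U, open U -> measurable (X @^-1` U)) -> borel_measurable X.
Proof.
move=> mX; apply: smallest_sub => //; split.
- by rewrite /= preimage_set0.
- by move=> B mB; rewrite /= setTD preimage_setC; exact: measurableC.
- by move=> F mF; rewrite /= preimage_bigcup; exact: bigcup_measurable.
Qed.

Lemma borel_open (T : topologicalType) (U : set T) : open U -> borel U.
Proof. by move=> oU; exact: sub_sigma_algebra. Qed.

(** A countable dense set as a sequence, which turns the union over a dense set
    in [borel_measurable_mul] into one indexed by natural numbers. *)
Lemma separable_dense_seq (T : topologicalType) (x0 : T) :
  separable T -> exists e : nat -> T,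
    forall (x : T) (U : set T), nbhs x U -> exists n, U (e n).
Proof.
case=> D [/countable_injP [f injf] dD].
(* The sequence inverts an injection of the dense set into nat; indices outside
   the image get the arbitrary value x0. *)
exists (fun n => xget x0 [set a | D a /\ f a = n]) => x U xU.
have [|y [yU yD]] := dD U° _ (open_interior U).
  by exists x; exact: xU.
exists (f y); case: xgetP => [z _ [Dz fzy]|/(_ y)]; last by case.
by rewrite (injf _ _ _ _ fzy) ?inE//; exact: interior_subset.
Qed.

Lemma mdist_mul_le (R : realType) (G : metricSemigroupType R) (a b a' b' : G) :
  mdist (a * b)%g (a' * b')%g <= mdist a a' + mdist b b'.
Proof.
rewrite (le_trans (metric_triangle _ (a' * b)%g _))//.
by rewrite mdist_mulr mdist_mull.
Qed.

Lemma mdist_nbhs (R : realType) (M : metricType R) (x : M) (e : R) :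
  0 < e -> nbhs x [set y | mdist x y < e].
Proof. by move=> e0; rewrite -ballEmdist; exact: nbhsx_ballx. Qed.

(** Multiplication is jointly continuous by [mdist_mul_le], so an open set of
    products is a union of products of balls; separability makes countably
    many balls enough. *)
Lemma borel_measurable_mul (R : realType) (G : metricSemigroupType R)
    (d : measure_display) (Omega : measurableType d) (X Y : Omega -> G) :
  separable G -> borel_measurable X -> borel_measurable Y ->
  borel_measurable (fun w => X w * Y w)%g.
Proof.
move=> sG mX mY; apply: borel_measurable_open => U oU.
have [e eP] := separable_dense_seq (X point) sG.
pose B (a : G) k := [set x | mdist a x < k.+1%:R^-1 :> R].
have oB a k : open (B a k).
  rewrite openE => x ax; apply/metricType_numDomainType.nbhs_mdistP.
  exists (k.+1%:R^-1 - mdist a x); first by rewrite /= subr_gt0.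
  move=> y /= xy; rewrite /B/= (le_lt_trans (metric_triangle _ x _))//.
  by rewrite -ltrBrDl.
have -> : (fun w => X w * Y w)%g @^-1` U = \bigcup_n \bigcup_m
    \bigcup_(k in [set k | forall x y, B (e n) k x -> B (e m) k y -> U (x * y)%g])
    (X @^-1` B (e n) k `&` Y @^-1` B (e m) k).
  apply/seteqP; split=> [w /= Uw|w [n _ [m _ [k/= kU [Xw Yw]]]]]; last exact: kU.
  have /metricType_numDomainType.nbhs_mdistP[r /= r0 rU] := open_nbhs_nbhs (conj oU Uw).
  (* Each factor moves by less than two radii, through the centre of its ball. *)
  have r40 : 0 < r / 4%:R by rewrite divr_gt0.
  have [k _ /(_ k (leqnn k)) /= kr] := near_infty_natSinv_lt (PosNum r40).
  have k0 : 0 < k.+1%:R^-1 :> R by rewrite invr_gt0.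
  have [n /= Xn] := eP _ _ (mdist_nbhs (X w) k0).
  have [m /= Ym] := eP _ _ (mdist_nbhs (Y w) k0).
  exists n => //; exists m => //; exists k => /=; last first.
    by rewrite /B/= 2!(metric_sym (e _)).
  rewrite /B/= => x y xn ym; apply: rU => /=.
  have := mdist_mul_le (X w) (Y w) x y.
  have := metric_triangle (X w) (e n) x.
  have := metric_triangle (Y w) (e m) y.
  by move: kr xn ym Xn Ym; set K := k.+1%:R^-1 => *; lra.
apply: bigcup_measurable => n _; apply: bigcup_measurable => m _.
apply: bigcup_measurable => k _.
by apply: measurableI; [apply: mX|apply: mY]; exact: borel_open.
Qed.

Lemma borel_measurable_cst (d : measure_display) (Omega : measurableType d)
  (T : topologicalType) (x : T) : borel_measurable (fun _ : Omega => x).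
Proof.
move=> B _; have [Bx|nBx] := pselect (B x).
  by rewrite (_ : _ @^-1` _ = setT)//; apply/seteqP; split.
by rewrite (_ : _ @^-1` _ = set0)//; apply/seteqP; split.
Qed.

Lemma borel_measurable_partial_prod (R : realType) (G : metricSemigroupType R)
    (d : measure_display) (Omega : measurableType d) (X : nat -> Omega -> G) n :
  separable G -> (0 < n)%N ->
  (forall i, (1 <= i <= n)%N -> borel_measurable (X i)) ->
  borel_measurable (fun w => partial_prod (X ^~ w) n).
Proof.
move=> sG; elim: n => [//|[|n] ih] _ mX; first exact: (mX 1%N).
apply: borel_measurable_mul => //; last first.
  by apply: (mX n.+2); rewrite /= leqnn.
by apply: ih => // i /andP[i1 i2]; apply: mX; rewrite i1 ltnW.
Qed.

Lemma measurable_mdist_gt (R : realType) (M : metricType R)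
    (d : measure_display) (Omega : measurableType d) (X : Omega -> M) z t :
  borel_measurable X -> measurable [set w | t < mdist z (X w)].
Proof.
move=> mX; apply: (mX [set x | t < mdist z x]); apply: borel_open.
rewrite openE => x /= zx; apply/metricType_numDomainType.nbhs_mdistP.
exists (mdist z x - t); first by rewrite /= subr_gt0.
move=> y /= xy.
have := metric_triangle z y x; rewrite (metric_sym y x); lra.
Qed.

(** * Partial products and sizes of increments *)

Lemma partial_prodS (G : semigroupType) (x : nat -> G) n :
  (0 < n)%N -> partial_prod x n.+1 = (partial_prod x n * x n.+1)%g.
Proof. by case: n. Qed.

Lemma partial_prodD (G : semigroupType) (x : nat -> G) k m :
  (0 < k)%N -> (0 < m)%N ->
  partial_prod x (k + m) =
  (partial_prod x k * partial_prod (fun i => x (k + i)%N) m)%g.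
Proof.
move=> k0; elim: m => [//|[|m] ih _]; first by rewrite /= !addn1 partial_prodS.
by rewrite addnS partial_prodS ?addn_gt0 ?k0// ih// -mulgA [in RHS]partial_prodS// !addnS.
Qed.

(** Both sides equal d(z, x z): the left one through d(y z, y x z), the right
    one through d(z z, z x z). The common value replaces a norm d(1, x). *)
Lemma mdist_mul_self (R : realType) (G : metricSemigroupType R) (y z x : G) :
  mdist y (y * x)%g = mdist z (z * x)%g.
Proof.
rewrite -(mdist_mulr z y) -mulgA mdist_mull.
by rewrite -[LHS](mdist_mull z) mulgA mdist_mulr.
Qed.

(** * Independence of disjoint blocks of random variables *)

Lemma borelI (T : topologicalType) (B C : set T) :
  borel B -> borel C -> borel (B `&` C).
Proof.
have /sigma_algebraP[//|_ _ _] := smallest_sigma_algebra setT (@open T).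
exact.
Qed.

Lemma borelT (T : topologicalType) : borel [set: T].
Proof. by apply: borel_open; exact: openT. Qed.

Section independence.
Context (R : realType) (d : measure_display) (Omega : measurableType d)
  (mu : probability Omega R).
Implicit Types (C : set (set Omega)) (E F : set Omega).

(** One half of the pi-lambda argument: for a fixed F, the measurable sets that
    satisfy the product rule with F form a Dynkin system. *)
Lemma product_rule_g_sigma_algebra C F :
  setI_closed C -> (forall E, C E -> measurable E) -> measurable F ->
  (forall E, C E -> mu (E `&` F) = mu E * mu F)%E ->
  forall E, <<s C >> E -> measurable E /\ (mu (E `&` F) = mu E * mu F)%E.
Proof.
move=> CI mC mF CF E; rewrite -setI_closed_g_dynkin_g_sigma_algebra//.
have finF : mu F \is a fin_num by exact: fin_num_measure.
move: E; apply: smallest_sub => [|E CE] /=; last by split; [exact: mC|exact: CF].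
split.
- by split => //; rewrite setTI probability_setT mul1e.
- move=> E [mE EF]; split; first exact: measurableC.
  have finE : mu E \is a fin_num by exact: fin_num_measure.
  rewrite setIC -setDE measureD//; last by rewrite ltey_eq finF.
  rewrite (setIC F) [X in (_ - X)%E]EF probability_setC//.
  by rewrite muleBl// ?mul1e//.
- move=> E tE EP; split; first by apply: bigcup_measurable => k _; case: (EP k).
  rewrite setI_bigcupl measure_bigcup//=; last 2 first.
  + by move=> k _; apply: measurableI => //; case: (EP k).
  + by apply: trivIset_setIr.
  rewrite measure_bigcup//=; last by move=> k _; case: (EP k).
  rewrite -(fineK finF) muleC -nneseriesZl//.
  by apply: eq_eseriesr => k _; rewrite muleC fineK//; case: (EP k).
Qed.

Context (T : topologicalType) (I : choiceType) (A : set I) (X : I -> Omega -> T).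
Hypothesis mX : forall i, A i -> borel_measurable (X i).

(** A pi-system generating the sigma-algebra of the variables X i, i in J. *)
Definition cylinders (J : set I) : set (set Omega) :=
  [set E | exists (K : {fset I}) (B : I -> set T),
    [/\ [set` K] `<=` J, forall i, borel (B i) &
        E = \bigcap_(i in [set` K]) (X i @^-1` B i)]].

Lemma cylinders_setI_closed J : setI_closed (cylinders J).
Proof.
move=> _ _ [K1 [B1 [K1J mB1 ->]]] [K2 [B2 [K2J mB2 ->]]].
exists (K1 `|` K2)%fset, (fun i => (if i \in K1 then B1 i else setT) `&`
  (if i \in K2 then B2 i else setT)); split.
- by move=> i /=; rewrite inE => /orP[/K1J|/K2J].
- by move=> i; apply: borelI; case: ifP => // _; exact: borelT.
- apply/seteqP; split => [w [w1 w2] i /= _|w /= h].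
    by split; case: ifPn => // iK; [exact: w1|exact: w2].
  split=> i /= iK; have /= := h i; rewrite inE iK ?orbT => /(_ isT)[]//.
Qed.

Lemma cylinders_measurable J E : J `<=` A -> cylinders J E -> measurable E.
Proof.
move=> JA [K [B [KJ mB ->]]]; apply: fin_bigcap_measurable => // i /KJ/JA Ai.
exact: mX.
Qed.

Lemma sub_generated_cylinders J i B : J i -> borel B ->
  <<s cylinders J >> (X i @^-1` B).
Proof.
move=> Ji mB; apply: sub_sigma_algebra; exists [fset i]%fset, (fun=> B); split => //.
  by move=> j /=; rewrite inE => /eqP ->.
by rewrite set_fset1 bigcap_set1.
Qed.

Hypothesis indX : independent_on mu A X.

(** The product rule for a finite subfamily, applied to the union of the two
    index sets: disjointness lets one family of Borel sets serve both. *)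
Lemma cylinders_independent J1 J2 E1 E2 : J1 `<=` A -> J2 `<=` A ->
  J1 `&` J2 = set0 -> cylinders J1 E1 -> cylinders J2 E2 ->
  (mu (E1 `&` E2) = mu E1 * mu E2)%E.
Proof.
move=> J1A J2A J12 [K1 [B1 [K1J mB1 ->]]] [K2 [B2 [K2J mB2 ->]]].
have K12 i : i \in K2 -> i \notin K1.
  move=> i2; apply/negP => i1; suff: (J1 `&` J2) i by rewrite J12.
  by split; [exact: K1J|exact: K2J].
pose B i := if i \in K1 then B1 i else B2 i.
have mB i : borel (B i) by rewrite /B; case: ifP.
have -> : \bigcap_(i in [set` K1]) (X i @^-1` B1 i) `&`
    \bigcap_(i in [set` K2]) (X i @^-1` B2 i) =
    \bigcap_(i in [set` (K1 `|` K2)%fset]) (X i @^-1` B i).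
  apply/seteqP; split => [w [w1 w2] i /=|w /= h].
    rewrite inE /B; case: ifPn => [iK _|_ /= iK]; first exact: w1.
    exact: w2.
  split=> i /= iK; have /= := h i; rewrite inE iK ?orbT => /(_ isT).
    by rewrite /B iK.
  by rewrite /B (negPf (K12 _ iK)).
rewrite (indX (B := B))//; last first.
  by move=> i /=; rewrite inE => /orP[/K1J/J1A|/K2J/J2A].
rewrite (indX (B := B1))//; last by move=> i /= /K1J/J1A.
rewrite (indX (B := B2))//; last by move=> i /= /K2J/J2A.
rewrite (big_fsetID _ (mem K1)) /=; congr (_ * _)%E.
  rewrite (_ : [fset x | x in _ & _]%fset = K1).
    by rewrite big_seq [RHS]big_seq; apply: eq_bigr => i iK; rewrite /B iK.
  by apply/fsetP => i; rewrite !inE /=; case: (i \in K1); rewrite ?andbF.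
rewrite (_ : [fset x | x in _ & _]%fset = K2).
  rewrite big_seq [RHS]big_seq; apply: eq_bigr => i iK.
  by rewrite /B (negPf (K12 _ iK)).
apply/fsetP => i; rewrite !inE /=; have [/K12 ->|_] := boolP (i \in K2).
  by rewrite orbT.
by rewrite orbF andbN.
Qed.

(** The pi-lambda argument is applied twice, extending first the event on the
    left and then the one on the right. *)
Lemma independent_generated J1 J2 E1 E2 : J1 `<=` A -> J2 `<=` A ->
  J1 `&` J2 = set0 -> <<s cylinders J1 >> E1 -> <<s cylinders J2 >> E2 ->
  (mu (E1 `&` E2) = mu E1 * mu E2)%E.
Proof.
move=> J1A J2A J12 sE1 sE2.
have mC1 E : cylinders J1 E -> measurable E by exact: cylinders_measurable.
have mC2 E : cylinders J2 E -> measurable E by exact: cylinders_measurable.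
have CI J : setI_closed (cylinders J) by exact: cylinders_setI_closed.
have rule1 F : cylinders J2 F -> measurable E1 /\ (mu (E1 `&` F) = mu E1 * mu F)%E.
  move=> CF; apply: (product_rule_g_sigma_algebra (CI J1) mC1 (mC2 _ CF) _ sE1).
  by move=> E CE; exact: (cylinders_independent J1A J2A).
have CT : cylinders J2 setT.
  exists fset0, (fun=> setT); split=> //; first by move=> i; exact: borelT.
  by apply/esym/seteqP; split.
have [mE1 _] := rule1 _ CT.
rewrite setIC muleC.
apply: (product_rule_g_sigma_algebra (CI J2) mC2 mE1 _ sE2).2.
by move=> F /rule1[_]; rewrite setIC muleC.
Qed.

End independence.

(** * The Hoffmann-Jorgensen inequality *)

Definition exceeds (R : realType) (Omega : Type) (A : set nat)
    (f : nat -> Omega -> R) (t : R) : set Omega :=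
  \bigcup_(n in A) [set w | t < f n w].

Definition first_exceeds (R : realType) (Omega : Type)
    (f : nat -> Omega -> R) (t : R) (k : nat) : set Omega :=
  [set w | t < f k w] `\` \bigcup_(i in [set i | (0 < i < k)%N]) [set w | t < f i w].

Lemma trivIset_first_exceeds (R : realType) (Omega : Type) (A : set nat)
    (f : nat -> Omega -> R) t :
  (forall n, A n -> (0 < n)%N) -> trivIset A (first_exceeds f t).
Proof.
move=> A0 i j Ai Aj [w [[ti fi] [tj fj]]].
have [ij|ji|//] := ltngtP i j.
- by exfalso; apply: fj; exists i => //=; rewrite A0//.
- by exfalso; apply: fi; exists j => //=; rewrite A0//.
Qed.

Lemma bigcup_first_exceeds (R : realType) (Omega : Type) (A : set nat)
    (f : nat -> Omega -> R) t :
  (forall n, A n -> (0 < n)%N) ->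
  (forall m n, (0 < m <= n)%N -> A n -> A m) ->
  \bigcup_(k in A) first_exceeds f t k = exceeds A f t.
Proof.
move=> A0 dA; apply/seteqP; split=> [w [k Ak [tk _]]|w [n An tn]].
  by exists k.
have ex : exists n, (0 < n)%N && (t < f n w) by exists n; rewrite A0.
have [k /andP[k0 tk] kmin] := ex_minnP ex.
have kn : (k <= n)%N by apply: kmin; rewrite A0.
exists k; first by apply: dA An; rewrite k0.
split=> // -[i /= /andP[i0 ik] ti].
by have := kmin i; rewrite i0 ti leqNgt ik => /(_ isT).
Qed.

(** In probabilistic terms: if V has conditional probability at most c given
    each of the disjoint events T k, then so it has given their union. *)
Lemma measure_bigcup_le_mul (R : realType) (d : measure_display)
    (Omega : measurableType d) (mu : probability Omega R) (A : set nat)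
    (T V : nat -> set Omega) (c : \bar R) : c \is a fin_num ->
  (forall k, A k -> measurable (T k)) -> (forall k, A k -> measurable (V k)) ->
  trivIset A T -> (forall k, A k -> (mu (T k `&` V k) <= c * mu (T k))%E) ->
  (mu (\bigcup_(k in A) (T k `&` V k)) <= c * mu (\bigcup_(k in A) T k))%E.
Proof.
move=> finc mT mV tT TV; rewrite !measure_bigcup//; last 2 first.
- by move=> k Ak; apply: measurableI; [exact: mT|exact: mV].
- exact: trivIset_setIr.
rewrite -(fineK finc) -nneseriesZl//.
by apply: lee_nneseries => // k /[!inE] Ak; rewrite fineK// TV.
Qed.

Section hoffmann_jorgensen.
Context (R : realType) (d : measure_display) (Omega : measurableType d)
  (mu : probability Omega R) (G : metricSemigroupType R) (z0 z1 : G)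
  (A : set nat) (X : nat -> Omega -> G).
Hypothesis A_gt0 : forall n, A n -> (0 < n)%N.
Hypothesis A_down : forall m n, (0 < m <= n)%N -> A n -> A m.
Hypothesis sG : separable G.
Hypothesis mX : forall n, A n -> borel_measurable (X n).
Hypothesis indX : independent_on mu A X.

Definition walk_dist n w := mdist z1 (z0 * partial_prod (X ^~ w) n)%g.
Definition step_size n w := mdist z0 (z0 * X n w)%g.
Definition block_size k m w :=
  mdist z0 (z0 * partial_prod (fun i => X (k + i)%N w) m)%g.

Lemma block_size_mdist k m w : (0 < k)%N -> (0 < m)%N ->
  block_size k m w =
  mdist (z0 * partial_prod (X ^~ w) k)%g (z0 * partial_prod (X ^~ w) (k + m))%g.
Proof.
by move=> k0 m0; rewrite partial_prodD// mulgA -[RHS](mdist_mul_self z0).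
Qed.

Lemma step_size_mdist k w : (0 < k)%N ->
  step_size k.+1 w =
  mdist (z0 * partial_prod (X ^~ w) k)%g (z0 * partial_prod (X ^~ w) k.+1)%g.
Proof.
by move=> k0; rewrite partial_prodS// mulgA -[RHS](mdist_mul_self z0).
Qed.

Lemma block_size_le k m w : (0 < k)%N -> (0 < m)%N ->
  block_size k m w <= walk_dist k w + walk_dist (k + m) w.
Proof.
move=> k0 m0; rewrite block_size_mdist//.
by rewrite (le_trans (metric_triangle _ z1 _))// (metric_sym _ z1).
Qed.

Lemma walk_distD_le k m w : (0 < k)%N -> (0 < m)%N ->
  walk_dist (k + m) w <= walk_dist k w + block_size k m w.
Proof.
by move=> k0 m0; rewrite block_size_mdist//; exact: metric_triangle.
Qed.

Lemma walk_distS_le k w : (0 < k)%N ->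
  walk_dist k.+1 w <= walk_dist k w + step_size k.+1 w.
Proof. by move=> k0; rewrite step_size_mdist//; exact: metric_triangle. Qed.

Lemma walk_dist1_le w : walk_dist 1 w <= mdist z1 z0 + step_size 1 w.
Proof. exact: metric_triangle. Qed.

Lemma measurable_walk_gt n t : A n -> measurable [set w | t < walk_dist n w].
Proof.
move=> An; apply: measurable_mdist_gt.
apply: borel_measurable_mul => //; first exact: borel_measurable_cst.
apply: borel_measurable_partial_prod => //; first exact: A_gt0.
by move=> i ilen; apply: mX; exact: A_down ilen An.
Qed.

Lemma measurable_step_gt n t : A n -> measurable [set w | t < step_size n w].
Proof.
move=> An; apply: measurable_mdist_gt.
by apply: borel_measurable_mul => //; [exact: borel_measurable_cst|exact: mX].
Qed.

Lemma measurable_exceeds_walk t : measurable (exceeds A walk_dist t).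
Proof. by apply: bigcup_measurable => n; exact: measurable_walk_gt. Qed.

Lemma measurable_exceeds_step t : measurable (exceeds A step_size t).
Proof. by apply: bigcup_measurable => n; exact: measurable_step_gt. Qed.

Definition later_block_exceeds u k : set Omega :=
  \bigcup_(m in [set m | (0 < m)%N /\ A (k + m)%N]) [set w | u < block_size k m w].

(** The measurable space is changed to Omega with the sigma-algebra generated
    by the X i, i in J, so that the measurability lemmas for products also show
    which events belong to the past or to the future of a given time. *)
Lemma borel_measurable_generated (J : set nat) i : J i ->
  borel_measurable (X i : g_sigma_algebraType (cylinders X J) -> G).
Proof. by move=> Ji B mB; exact: sub_generated_cylinders. Qed.

Lemma first_exceeds_generated t k : (0 < k)%N ->
  <<s cylinders X [set i | (0 < i <= k)%N] >> (first_exceeds walk_dist t k).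
Proof.
set J := [set i | _] => k0.
have mw i : J i -> measurable
   ([set w | t < walk_dist i w] : set (g_sigma_algebraType (cylinders X J))).
  move=> /= /andP[i0 ik].
  apply: (@measurable_mdist_gt _ _ _ (g_sigma_algebraType (cylinders X J))).
  apply: borel_measurable_mul => //; first exact: borel_measurable_cst.
  apply: borel_measurable_partial_prod => // j /andP[j0 ji].
  by apply: borel_measurable_generated; rewrite /J/= j0 (leq_trans ji).
apply: (@measurableD _ (g_sigma_algebraType (cylinders X J))).
  by apply: mw; rewrite /J/= k0 leqnn.
apply: bigcup_measurable => i /= /andP[i0 ik].
by apply: mw; rewrite /J/= i0 ltnW.
Qed.

Lemma later_block_exceeds_generated u k :
  <<s cylinders X [set i | A i /\ (k < i)%N] >> (later_block_exceeds u k).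
Proof.
set J := [set i | _].
apply: (@bigcup_measurable _ (g_sigma_algebraType (cylinders X J))).
move=> m [m0 Akm].
apply: (@measurable_mdist_gt _ _ _ (g_sigma_algebraType (cylinders X J))).
apply: borel_measurable_mul => //; first exact: borel_measurable_cst.
apply: (@borel_measurable_partial_prod _ _ _ (g_sigma_algebraType (cylinders X J))
  (fun i => X (k + i)%N)) => // j /andP[j0 jm].
apply: borel_measurable_generated; split => /=.
  by apply: A_down Akm; rewrite addn_gt0 j0 orbT leq_add2l.
by rewrite -[ltnLHS]addn0 ltn_add2l.
Qed.

(** At the first passage k above t, the walk was still within t one step
    before, or at z0 when k = 1, which is why t has to be at least d(z1, z0).
    So it is within t + s at time k if all steps are at most s, and the rest
    of the excess is due to the factors after k. *)
Lemma exceeds_sum_sub t s u : mdist z1 z0 <= t -> 0 <= u ->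
  exceeds A walk_dist (t + s + u) `<=` exceeds A step_size s `|`
    \bigcup_(k in A) (first_exceeds walk_dist t k `&` later_block_exceeds u k).
Proof.
move=> Dt u0 w En; have [|nF] := pselect (exceeds A step_size s w); first by left.
have stepA n : A n -> step_size n w <= s.
  by move=> An; rewrite leNgt; apply/negP => sn; apply: nF; exists n.
right; case: En => n An /= gn.
have s0 : 0 <= s by rewrite (le_trans _ (stepA _ An))// mdist_ge0.
have : exceeds A walk_dist t w by exists n => //=; lra.
rewrite -bigcup_first_exceeds// => -[k Ak fk].
exists k => //; split=> //; have k0 := A_gt0 Ak.
have gk : walk_dist k w <= t + s.
  case: k k0 Ak fk => [//|[_ A1 _|k _ Ak [_ fk]]].
    by have := walk_dist1_le w; have := stepA _ A1; lra.
  have := walk_distS_le w (ltn0Sn k); have := stepA _ Ak.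
  suff : walk_dist k.+1 w <= t by lra.
  rewrite leNgt; apply/negP => tk; apply: fk; exists k.+1 => //=.
(* n = k is excluded by the bound at time k, n < k by the choice of k. *)
have kn : (k < n)%N.
  have n0 := A_gt0 An.
  rewrite ltnNge; apply/negP; rewrite leq_eqVlt => /orP[/eqP nk|nk].
    by move: gn; rewrite nk; lra.
  by case: fk => _; apply; exists n => //=; [rewrite n0|lra].
exists (n - k)%N; first by rewrite /= subn_gt0 kn subnKC// ltnW.
have := @walk_distD_le k (n - k)%N w k0; rewrite subn_gt0 kn => /(_ isT) /=.
by rewrite subnKC ?(ltnW kn)//; lra.
Qed.

(** A block of size > 2a joins two points of the walk, which cannot both be
    within a of z1. *)
Lemma later_block_exceeds_sub a k : A k ->
  later_block_exceeds (2%:R * a) k `<=` exceeds A walk_dist a.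
Proof.
move=> Ak w [m [m0 Akm] /= um].
have := block_size_le w (A_gt0 Ak) m0.
have [ak _|ka h] := ltP a (walk_dist k w); first by exists k.
by exists (k + m)%N => //=; lra.
Qed.

(** The decomposition of [exceeds_sum_sub] into disjoint first passages,
    each independent of the blocks that follow it. *)
Theorem hoffmann_jorgensen t s a : mdist z1 z0 <= t -> 0 <= a ->
  (mu (exceeds A walk_dist (t + s + 2%:R * a)) <=
   mu (exceeds A step_size s) +
   mu (exceeds A walk_dist a) * mu (exceeds A walk_dist t))%E.
Proof.
move=> Dt a0.
have mT k : A k -> measurable (first_exceeds walk_dist t k).
  move=> Ak; apply: measurableD; first exact: measurable_walk_gt.
  apply: bigcup_measurable => i /= /andP[i0 ik]; apply: measurable_walk_gt.
  by apply: A_down Ak; rewrite i0 ltnW.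
have mV k : A k -> measurable (later_block_exceeds (2%:R * a) k).
  move=> Ak; apply: bigcup_measurable => m [m0 Akm].
  apply: measurable_mdist_gt.
  apply: borel_measurable_mul => //; first exact: borel_measurable_cst.
  apply: (@borel_measurable_partial_prod _ _ _ Omega (fun i => X (k + i)%N)) => //.
  move=> j /andP[j0 jm]; apply: mX; apply: A_down Akm.
  by rewrite addn_gt0 j0 orbT leq_add2l.
have mTV : measurable (\bigcup_(k in A)
    (first_exceeds walk_dist t k `&` later_block_exceeds (2%:R * a) k)).
  by apply: bigcup_measurable => k Ak; apply: measurableI; [exact: mT|exact: mV].
apply: (@le_trans _ _ (mu (exceeds A step_size s `|` \bigcup_(k in A)
    (first_exceeds walk_dist t k `&` later_block_exceeds (2%:R * a) k)))).
  apply: le_measure; rewrite ?inE.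
  - exact: measurable_exceeds_walk.
  - by apply: measurableU => //; exact: measurable_exceeds_step.
  - by apply: exceeds_sum_sub => //; rewrite mulr_ge0.
apply: le_trans (measureU2 _ _ _) _ => //; first exact: measurable_exceeds_step.
rewrite leeD2l// -(bigcup_first_exceeds walk_dist t A_gt0 A_down).
have mE := measurable_exceeds_walk a.
apply: measure_bigcup_le_mul => //; first exact: fin_num_measure.
  exact: trivIset_first_exceeds.
move=> k Ak.
rewrite (@independent_generated _ _ _ _ _ _ A X mX indX [set i | (0 < i <= k)%N]
   [set i | A i /\ (k < i)%N])//.
- rewrite muleC lee_wpmul2r//; apply: le_measure; rewrite ?inE//.
    exact: mV.
  exact: later_block_exceeds_sub.
- by move=> i /= ik; exact: A_down ik Ak.
- by move=> i [].
- by apply/seteqP; split=> // i [/= /andP[_ ik] [_]]; rewrite ltnNge ik.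
- by apply: first_exceeds_generated; exact: A_gt0.
- exact: later_block_exceeds_generated.
Qed.

End hoffmann_jorgensen.

(** * Moments as weighted sums of tails *)

Section layer_cake.
Context (R : realType) (d : measure_display) (Omega : measurableType d)
  (mu : probability Omega R) (A : set nat) (f : nat -> Omega -> R) (p b : R).
Hypothesis f_ge0 : forall n w, 0 <= f n w.
Hypothesis mf : forall n t, A n -> measurable [set w | t < f n w].
Hypothesis p_gt0 : 0 < p.

Definition sup_pow w := ereal_sup [set (f n w `^ p)%:E | n in A].

Lemma measurable_sup_pow : measurable_fun setT sup_pow.
Proof.
apply: (measurability _ (ErealGenOInfty.measurableE R)) => //.
move=> _ [_ [x ->] <-]; rewrite setTI.
have -> : sup_pow @^-1` `]x%:E, +oo[%classic =
    \bigcup_(n in A) [set w | x < f n w `^ p].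
  apply/seteqP; split => [w /=|w [n An /= xn]].
    rewrite in_itv/= andbT => /ereal_sup_gt [_ [n An <-]]; rewrite lte_fin.
    by exists n.
  rewrite in_itv/= andbT (@lt_le_trans _ _ (f n w `^ p)%:E)//.
  by apply: ereal_sup_ubound; exists n.
apply: bigcup_measurable => n An.
have mfn : measurable_fun setT (f n).
  apply: (measurability _ (RGenOInfty.measurableE R)) => //.
  by move=> _ [_ [t ->] <-]; rewrite setTI preimage_itvoy; exact: mf.
have mfp : measurable_fun setT (fun w => f n w `^ p).
  exact: measurableT_comp (measurable_powR p) mfn.
by have := mfp measurableT _ (measurable_itv `]x, +oo[); rewrite setTI preimage_itvoy.
Qed.

Let mE t : measurable (exceeds A f t).
Proof. by apply: bigcup_measurable => n; exact: mf. Qed.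

Hypothesis b_gt0 : 0 < b.
Let q : R := 3%:R `^ p.
Let level k := exceeds A f (b * 3%:R ^+ k).

Lemma powR_level k : (b * 3%:R ^+ k) `^ p = b `^ p * q ^+ k.
Proof.
rewrite powRM ?exprn_ge0// ?(ltW b_gt0)//; congr (_ * _).
by rewrite -powR_mulrn// -powRrM mulrC powRrM powR_mulrn// powR_ge0.
Qed.

(** A value between b 3^k and b 3^(k+1) has p-th power at most b^p q^(k+1),
    which is already a term of the series; b^p accounts for values below b. *)
Lemma sup_pow_le w : (sup_pow w <=
  (b `^ p)%:E + \sum_(0 <= k <oo) (b `^ p * q ^+ k.+1 * \1_(level k) w)%:E)%E.
Proof.
have t0 k : 0 <= b `^ p * q ^+ k.+1 * \1_(level k) w.
  by rewrite !mulr_ge0// ?exprn_ge0// powR_ge0.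
apply: ge_ereal_sup => _ [n An <-].
have ex : exists m, f n w <= b * 3%:R ^+ m.
  exists (Num.truncn (f n w / b)).+1; rewrite mulrC -ler_pdivrMr//.
  rewrite (le_trans (ltW (truncnS_gt _)))//.
  by rewrite -natrX ler_nat ltnW// ltn_expl.
have [[|k] fk kmin] := ex_minnP ex.
  apply: (@le_trans _ _ (b `^ p)%:E); last first.
    by rewrite leeDl// nneseries_ge0// => k _; rewrite lee_fin.
  rewrite lee_fin ge0_ler_powR ?nnegrE ?(ltW p_gt0) ?(ltW b_gt0)//.
  by rewrite expr0 mulr1 in fk.
have wk : level k w.
  exists n => //=; rewrite ltNge; apply/negP => /kmin.
  by rewrite ltnn.
apply: (@le_trans _ _ (b `^ p * q ^+ k.+1 * \1_(level k) w)%:E).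
  rewrite lee_fin indicE mem_set// mulr1 -powR_level.
  rewrite ge0_ler_powR ?nnegrE ?(ltW p_gt0)//.
  by rewrite mulr_ge0 ?exprn_ge0 ?(ltW b_gt0).
rewrite -[leLHS]add0e leeD ?lee_fin ?powR_ge0//.
apply: le_trans (nneseries_lim_ge k.+1 _) => [|m _ _]; last by rewrite lee_fin.
rewrite big_nat_recr//= -[leLHS]add0e leeD//.
by apply: sume_ge0 => m _; rewrite lee_fin.
Qed.

Lemma q_gt1 : 1 < q.
Proof.
have <- : 1 `^ p = 1 :> R by rewrite powR1.
by rewrite /q gt0_ltr_powR ?nnegrE// ltr1n.
Qed.

(** The partial sum is dominated by a geometric one, hence by q / (q - 1) times
    its last term, and the last level that is exceeded bounds the supremum
    from below. *)
Lemma level_sum_le w K : A !=set0 ->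
  ((\sum_(0 <= k < K) q ^+ k * \1_(level k) w)%:E <=
   (q / (q - 1) / b `^ p)%:E * sup_pow w)%E.
Proof.
move=> [n0 An0]; have q1 := q_gt1.
have q10 : 0 < q - 1 by rewrite subr_gt0.
have bp0 : 0 < b `^ p by rewrite powR_gt0.
have c0 : 0 <= q / (q - 1) / b `^ p.
  by rewrite !divr_ge0 ?(ltW bp0) ?(ltW q10)// (le_trans ler01 (ltW q1)).
elim: K => [|K ih].
  rewrite big_geq// mule_ge0 ?lee_fin//.
  apply: (@le_trans _ _ (f n0 w `^ p)%:E); first by rewrite lee_fin powR_ge0.
  by apply: ereal_sup_ubound; exists n0.
have [[n An /= fn]|nK] := pselect (level K w); last first.
  by rewrite big_nat_recr//= indicE memNset// mulr0 addr0.
apply: (@le_trans _ _ (q / (q - 1) / b `^ p * f n w `^ p)%:E); last first.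
  rewrite EFinM lee_pmul2l//=; first by apply: ereal_sup_ubound; exists n.
  by rewrite lte_fin !divr_gt0// (lt_trans ltr01).
rewrite lee_fin; apply: (@le_trans _ _ (\sum_(0 <= k < K.+1) q ^+ k)).
  apply: ler_sum => k _.
  by rewrite ler_piMr ?exprn_ge0 ?(le_trans ler01 (ltW q1))//.
apply: (@le_trans _ _ (q / (q - 1) * q ^+ K)).
  rewrite mulrAC ler_pdivlMr// mulrC big_mkord -subrX1 exprS; lra.
rewrite -!mulrA ler_wpM2l ?(le_trans ler01 (ltW q1))// ler_wpM2l ?invr_ge0 ?(ltW q10)//.
rewrite ler_pdivlMl// -powR_level ge0_ler_powR ?nnegrE ?(ltW p_gt0) ?(ltW fn)//.
by rewrite mulr_ge0 ?exprn_ge0 ?(ltW b_gt0).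
Qed.

Let mind k (c : R) : measurable_fun setT (fun w => (c * \1_(level k) w)%:E).
Proof.
apply/measurable_EFinP; apply: measurable_funM => //.
exact/measurable_indic/mE.
Qed.

Let int_ind k (c : R) : 0 <= c ->
  (\int[mu]_w (c * \1_(level k) w)%:E = c%:E * mu (level k))%E.
Proof.
move=> c0; under eq_integral do rewrite EFinM.
rewrite ge0_integralZl//.
- by rewrite integral_indic ?setIT//; exact: mE.
- by apply/measurable_EFinP/measurable_indic/mE.
Qed.

Lemma integral_sup_pow_le : A !=set0 -> (\int[mu]_w sup_pow w <= (b `^ p)%:E +
  \sum_(0 <= k <oo) (b `^ p * q ^+ k.+1)%:E * mu (level k))%E.
Proof.
move=> [n An].
have q0 : 0 <= q by rewrite powR_ge0.
have c0 k : 0 <= b `^ p * q ^+ k.+1 by rewrite mulr_ge0 ?exprn_ge0 ?powR_ge0.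
have t0 k w : (0 <= (b `^ p * q ^+ k.+1 * \1_(level k) w)%:E)%E.
  by rewrite lee_fin mulr_ge0.
have ms : measurable_fun setT (fun w =>
    \sum_(0 <= k <oo) (b `^ p * q ^+ k.+1 * \1_(level k) w)%:E)%E.
  by apply: ge0_emeasurable_sum => // k _; exact: mind.
apply: (@le_trans _ _ (\int[mu]_w ((b `^ p)%:E +
  \sum_(0 <= k <oo) (b `^ p * q ^+ k.+1 * \1_(level k) w)%:E)))%E.
  apply: ge0_le_integral => //.
  - move=> w _; apply: (@le_trans _ _ (f n w `^ p)%:E).
      by rewrite lee_fin powR_ge0.
    by apply: ereal_sup_ubound; exists n.
  - exact: measurable_sup_pow.
  - by apply: emeasurable_funD => //; exact: measurable_cst.
  - by move=> w _; exact: sup_pow_le.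
rewrite ge0_integralD//; last 2 first.
- by move=> w _; rewrite lee_fin powR_ge0.
- by move=> w _; apply: nneseries_ge0 => k _.
rewrite integral_cst// [X in (_ * X + _)%E]probability_setT mule1 leeD2l//.
rewrite integral_nneseries//.
by apply: lee_nneseries => k *; rewrite int_ind// mule_ge0// lee_fin.
Qed.

Lemma level_tail_sum_le K : A !=set0 ->
  (\sum_(0 <= k < K) (q ^+ k)%:E * mu (level k) <=
   (q / (q - 1) / b `^ p)%:E * \int[mu]_w sup_pow w)%E.
Proof.
move=> A0; have q1 := q_gt1.
have q0 : 0 <= q by rewrite powR_ge0.
have c0 : 0 <= q / (q - 1) / b `^ p.
  by rewrite !divr_ge0 ?powR_ge0 ?subr_ge0 ?(ltW q1).
have s0 w : (0 <= sup_pow w)%E.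
  have [n An] := A0.
  apply: (@le_trans _ _ (f n w `^ p)%:E); first by rewrite lee_fin powR_ge0.
  by apply: ereal_sup_ubound; exists n.
have t0 k w : (0 <= (q ^+ k * \1_(level k) w)%:E)%E.
  by rewrite lee_fin mulr_ge0// exprn_ge0.
rewrite -ge0_integralZl//; last exact: measurable_sup_pow.
under eq_bigr => k _ do rewrite -int_ind ?exprn_ge0//.
rewrite -ge0_integral_sum//.
apply: ge0_le_integral => //.
- by move=> w _; apply: sume_ge0.
- exact: emeasurable_sum.
- by apply: measurable_funeM; exact: measurable_sup_pow.
- by move=> w _; rewrite sumEFin; exact: level_sum_le.
Qed.

End layer_cake.

(** * Comparison of moments *)

(** Shifting the sum by one index multiplies it by q, so the recursive term
    contributes half of the previous partial sum and a bound by twice the rest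
    is stable under induction. *)
Lemma weighted_sum_le (R : realType) (q C : R) (r e : nat -> R) : 0 < q ->
  e 0%N <= 1 -> (forall k, e k.+1 <= r k + (2%:R * q)^-1 * e k) ->
  (forall K, \sum_(0 <= k < K) q ^+ k * r k <= C) ->
  forall K, \sum_(0 <= k < K) q ^+ k * e k <= 2%:R * (1 + q * C).
Proof.
move=> q0 e0 er rC K.
have C0 : 0 <= C by have := rC 0%N; rewrite big_geq.
have qC0 : 0 <= q * C by rewrite mulr_ge0// ltW.
elim: K => [|K ih]; first by rewrite big_geq//; lra.
rewrite big_nat_recl// expr0 mul1r.
have : \sum_(0 <= k < K) q ^+ k.+1 * e k.+1 <=
    q * (\sum_(0 <= k < K) q ^+ k * r k) + 2%:R^-1 * \sum_(0 <= k < K) q ^+ k * e k.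
  rewrite !mulr_sumr -big_split /=; apply: ler_sum => k _.
  have -> : q * (q ^+ k * r k) + 2%:R^-1 * (q ^+ k * e k) =
      q ^+ k.+1 * (r k + (2%:R * q)^-1 * e k).
    by rewrite exprS; field; rewrite gt_eqF.
  by rewrite ler_wpM2l// exprn_ge0// ltW.
have : q * (\sum_(0 <= k < K) q ^+ k * r k) <= q * C by rewrite ler_wpM2l// ltW.
lra.
Qed.

Section moment_transfer.
Context (R : realType) (d : measure_display) (Omega : measurableType d)
  (mu : probability Omega R) (A : set nat) (f g : nat -> Omega -> R) (p b : R).

(** Finiteness of the p-th moment of sup g passes to sup f as soon as the tail
    of sup f at each level is controlled by the previous level; the weight
    1 / (2 * 3^p) is what [weighted_sum_le] absorbs at the growth rate 3^p of
    the p-th powers of the levels. *)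
Lemma moment_transfer : A !=set0 ->
  (forall n w, 0 <= f n w) -> (forall n w, 0 <= g n w) ->
  (forall n t, A n -> measurable [set w | t < f n w]) ->
  (forall n t, A n -> measurable [set w | t < g n w]) ->
  0 < p -> 0 < b ->
  (forall k, mu (exceeds A f (b * 3%:R ^+ k.+1)) <=
    mu (exceeds A g (b * 3%:R ^+ k)) +
    ((2%:R * 3%:R `^ p)^-1)%:E * mu (exceeds A f (b * 3%:R ^+ k)))%E ->
  (\int[mu]_w sup_pow A g p w < +oo)%E -> (\int[mu]_w sup_pow A f p w < +oo)%E.
Proof.
move=> A0 f0 g0 mf mg p0 b0 step intg.
set q := 3%:R `^ p in step *.
have q0 : 0 < q by rewrite powR_gt0.
have [n An] := A0.
have mE h t : (forall n t, A n -> measurable [set w : Omega | t < h n w]) ->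
    mu (exceeds A h t) \is a fin_num.
  by move=> mh; apply: fin_num_measure; apply: bigcup_measurable => m; exact: mh.
pose e k := fine (mu (exceeds A f (b * 3%:R ^+ k))).
pose r k := fine (mu (exceeds A g (b * 3%:R ^+ k))).
have eE k : mu (exceeds A f (b * 3%:R ^+ k)) = (e k)%:E by rewrite fineK// mE.
have rE k : mu (exceeds A g (b * 3%:R ^+ k)) = (r k)%:E by rewrite fineK// mE.
have intg0 : (0 <= \int[mu]_w sup_pow A g p w)%E.
  apply: integral_ge0 => w _; apply: (@le_trans _ _ (g n w `^ p)%:E).
    by rewrite lee_fin powR_ge0.
  by apply: ereal_sup_ubound; exists n.
have fing : (\int[mu]_w sup_pow A g p w)%E \is a fin_num by rewrite ge0_fin_numE.
have eB : forall K, \sum_(0 <= k < K) q ^+ k * e k <=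
    2%:R * (1 + q * (q / (q - 1) / b `^ p * fine (\int[mu]_w sup_pow A g p w)%E)).
  apply: (@weighted_sum_le _ _ _ r) => //.
  - rewrite -lee_fin -eE; apply: probability_le1.
    by apply: bigcup_measurable => m; exact: mf.
  - by move=> k; rewrite -lee_fin EFinD EFinM -!eE -rE.
  - move=> K; rewrite -lee_fin EFinM fineK//.
    apply: le_trans (level_tail_sum_le mu g0 mg p0 b0 K A0).
    by rewrite -sumEFin; apply: lee_sum => k _; rewrite EFinM rE.
apply: le_lt_trans (integral_sup_pow_le mu f0 mf p0 b0 A0) _.
set B := (X in forall K, _ <= X) in eB.
apply: (@le_lt_trans _ _ (b `^ p + b `^ p * q * B)%:E); last by rewrite ltry.
rewrite EFinD leeD2l//; apply: lime_le.
  apply: is_cvg_nneseries => k _ _.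
  by rewrite mule_ge0// lee_fin mulr_ge0 ?powR_ge0// exprn_ge0// ltW.
apply: nearW => K; under eq_bigr => k _ do rewrite eE -EFinM.
rewrite sumEFin lee_fin.
have -> : \sum_(0 <= k < K) b `^ p * q ^+ k.+1 * e k =
    b `^ p * q * \sum_(0 <= k < K) q ^+ k * e k.
  by rewrite mulr_sumr; apply: eq_bigr => k _; rewrite exprS; ring.
by rewrite ler_wpM2l// mulr_ge0 ?powR_ge0// ltW.
Qed.

End moment_transfer.

(** Continuity from above: the events that the supremum exceeds n decrease to
    a null set. *)
Lemma ae_bounded_exceeds_small (R : realType) (d : measure_display)
    (Omega : measurableType d) (mu : probability Omega R) (A : set nat)
    (f : nat -> Omega -> R) (eps : R) :
  (forall n t, A n -> measurable [set w | t < f n w]) ->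
  {ae mu, forall w, (ereal_sup [set (f n w)%:E | n in A] < +oo)%E} ->
  0 < eps -> exists2 a, 0 <= a & (mu (exceeds A f a) <= eps%:E)%E.
Proof.
move=> mf [N [mN muN subN]] eps0.
pose E n := exceeds A f n%:R.
have mE n : measurable (E n) by apply: bigcup_measurable => m; exact: mf.
have mI : measurable (\bigcap_n E n) by exact: bigcapT_measurable.
have I0 : mu (\bigcap_n E n) = 0%E.
  apply/eqP; rewrite eq_le measure_ge0 andbT -muN; apply: le_measure; rewrite ?inE//.
  move=> w Iw; apply: subN => /= supoo.
  have [n supn] : exists n : nat, (ereal_sup [set (f n w)%:E | n in A] <= n%:R%:E)%E.
    case: ereal_sup supoo => [r _| |_]; [|by []|by exists 0%N; rewrite leNye].
    by exists (Num.truncn r).+1; rewrite lee_fin ltW// truncnS_gt.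
  have [m Am /= nm] := Iw n I.
  have : ((f m w)%:E <= n%:R%:E)%E.
    by apply: le_trans supn; apply: ereal_sup_ubound; exists m.
  by rewrite lee_fin leNgt nm.
have cE : mu \o E @ \oo --> mu (\bigcap_n E n).
  apply: nonincreasing_cvg_mu => //.
    by rewrite ltey_eq fin_num_measure.
  move=> n m nm; apply/subsetPset => w [k Ak /= mk]; exists k => //=.
  by apply: le_lt_trans mk; rewrite ler_nat.
rewrite I0 in cE.
have [n _ /(_ n (leqnn n)) /= En] := cvgr_lt _ (fine_cvg cE) _ eps0.
have finE : mu (E n) \is a fin_num by exact: fin_num_measure.
by exists n%:R => //; rewrite -/(E n) -(fineK finE) lee_fin ltW.
Qed.

(** * The equivalence of moments *)

(** The n-th step joins the points of the walk at times n - 1 and n, and for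
    n = 1 the first of them is z0: the step is at most twice the larger of the
    two distances to z1. *)
Lemma exceeds_step_sub (R : realType) (d : measure_display)
    (Omega : measurableType d) (G : metricSemigroupType R)
    (z0 z1 : G) (A : set nat) (X : nat -> Omega -> G) t :
  (forall n, A n -> (0 < n)%N) ->
  (forall m n, (0 < m <= n)%N -> A n -> A m) ->
  mdist z1 z0 <= t ->
  exceeds A (step_size z0 X) (3%:R * t) `<=` exceeds A (walk_dist z0 z1 X) t.
Proof.
move=> A0 dA Dt w [[|[|n]] An /= tn]; first by have := A0 _ An.
  exists 1%N => //=; move: tn.
  have := metric_triangle z0 z1 (z0 * X 1%N w)%g; rewrite (metric_sym z0 z1).
  rewrite /step_size /walk_dist /=; have := mdist_ge0 z1 z0; lra.
have An1 : A n.+1 by apply: dA An; rewrite ltnS leqnSn.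
have : step_size z0 X n.+2 w <= walk_dist z0 z1 X n.+1 w + walk_dist z0 z1 X n.+2 w.
  rewrite step_size_mdist// (le_trans (metric_triangle _ z1 _))//.
  by rewrite (metric_sym _ z1).
have [tn1 _|nt1 ?] := ltP t (walk_dist z0 z1 X n.+1 w); first by exists n.+1.
exists n.+2 => //=; have := mdist_ge0 z1 z0; lra.
Qed.

Theorem theorem1 (R : realType) (d : measure_display)
  (Omega : measurableType d) (mu : probability Omega R)
  (G : metricSemigroupType R) (z0 z1 : G)
  (A : set nat) (X : nat -> Omega -> G) :
  positive_initial_segment A ->
  separable G ->
  (forall n, A n -> borel_measurable (X n)) ->
  independent_on mu A X ->
  let S n w := partial_prod (fun i => X i w) n in
  {ae mu, forall w,
    (ereal_sup [set (mdist z1 (z0 * S n w)%g)%:E | n in A] < +oo)%E} ->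
  forall p : R, 0 < p ->
    (\int[mu]_w ereal_sup [set (mdist z0 (z0 * X n w)%g `^ p)%:E | n in A]
      < +oo)%E <->
    (\int[mu]_w ereal_sup [set (mdist z1 (z0 * S n w)%g `^ p)%:E | n in A]
      < +oo)%E.
Proof.
move=> segA sG mX indX S bdd p p0.
have A1 : A !=set0 by case: segA => [->|[N [N1 ->]]]; exists 1%N => //=.
have A_gt0 n : A n -> (0 < n)%N.
  by case: segA => [->//|[N [_ ->]] /= /andP[]].
have A_down m n : (0 < m <= n)%N -> A n -> A m.
  case: segA => [->|[N [_ ->]]] /= /andP[m0 mn]; first by [].
  by move=> /andP[_ nN]; rewrite m0 (leq_trans mn).
have mwalk n t : A n -> measurable [set w | t < walk_dist z0 z1 X n w].
  exact: measurable_walk_gt.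
have mstep n t : A n -> measurable [set w | t < step_size z0 X n w].
  exact: measurable_step_gt.
have walk0 n w : 0 <= walk_dist z0 z1 X n w by exact: mdist_ge0.
have step0 n w : 0 <= step_size z0 X n w by exact: mdist_ge0.
have q0 : 0 < 3%:R `^ p :> R by rewrite powR_gt0.
have D0 : 0 <= mdist z1 z0 :> R by exact: mdist_ge0.
have pow3 k : 1 <= 3%:R ^+ k :> R by rewrite exprn_ege1// ler1n.
split; last first.
  (* One added to d(z1, z0) only makes the base level positive. *)
  have b0 : 0 < mdist z1 z0 + 1 :> R by lra.
  apply: (moment_transfer A1 step0 walk0 mstep mwalk p0 b0) => k.
  apply: le_trans (leeDl _ _); last by rewrite mule_ge0// lee_fin invr_ge0; lra.
  apply: le_measure; rewrite ?inE.
  - exact: measurable_exceeds_step.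
  - exact: measurable_exceeds_walk.
  - rewrite exprS mulrCA; apply: exceeds_step_sub => //.
    by have := ler_peMr (ltW b0) (pow3 k); lra.
have eps0 : 0 < (2%:R * 3%:R `^ p)^-1 :> R by rewrite invr_gt0; lra.
have [a a0 Ea] := ae_bounded_exceeds_small mwalk bdd eps0.
(* From this base level on, t = s = b 3^k satisfies t >= d(z1, z0) and
   t + s + 2a <= 3t, the next level. *)
have b0 : 0 < mdist z1 z0 + 2%:R * a + 1 by lra.
apply: (moment_transfer A1 walk0 step0 mwalk mstep p0 b0) => k.
set t := _ * 3%:R ^+ k.
have tb : mdist z1 z0 + 2%:R * a + 1 <= t by exact: ler_peMr (ltW b0) (pow3 k).
have Dt : mdist z1 z0 <= t by lra.
apply: (@le_trans _ _ (mu (exceeds A (walk_dist z0 z1 X) (t + t + 2%:R * a)))).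
  apply: le_measure; rewrite ?inE; [exact: measurable_exceeds_walk..|].
  move=> w [n An /= tn]; exists n => //=; apply: le_lt_trans tn.
  by rewrite exprS mulrCA -/t; lra.
apply: le_trans (hoffmann_jorgensen A_gt0 A_down sG mX indX t Dt a0) _.
by rewrite leeD2l// lee_wpmul2r.
Qed.
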